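(* Let $G=\langle A,\beta\mid \beta^2=\alpha,\ \beta a\beta^{-1}=f(a)\ \text{for all } a\in A\rangle$ be a finite non-abelian group of order $2n$ ($n>1$), where $A$ is an abelian subgroup of index $2$, $\alpha\in A$, and $f$ is an automorphism of $A$ of order $2$ with $f(\alpha)=\alpha$. Let $X\subseteq A\setminus\{e\}$ and $Y\subseteq A$ satisfy $X\cap f(X)=Y\cap f(Y)=\emptyset$ and $|X|=|Y|$, and let $B=A\setminus(X\cup f(X))$. Then the Cayley graph $\Gamma=\mathrm{Cay}(G,X\cup Y\beta)$ is a DSRG if and only if: (i) $B$ is a subgroup of $A$; (ii) both $X$ and $Y$ are unions of cosets of $B$ in $A$; (iii) $X\cup f(X)=Y\cup f(Y)$ and $\overline{X}f(\overline{X})=\overline{Y}f(\overline{Y})$. In this case, $\Gamma$ has parameters $(2n,n-\ell,\frac{n-\ell}{2},\frac{n-3\ell}{2},\frac{n-\ell}{2})$, where $\ell=|B|$.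
   Context: $e$ denotes the identity. For a finite group $H$ and $S\subseteq H\setminus\{e\}$, $\mathrm{Cay}(H,S)$ is the directed graph with vertex set $H$ and an arc from $x$ to $y$ iff $yx^{-1}\in S$. $Y\beta=\{y\beta:y\in Y\}$, $f(X)=\{f(x):x\in X\}$. A DSRG with parameters $(N,k,\mu,\lambda,t)$ is a $k$-regular loopless directed graph on $N$ vertices such that every vertex $x$ has exactly $t$ vertices $z$ with $x\to z$ and $z\to x$, and for vertices $x\ne y$ the number of $z$ with $x\to z\to y$ is $\lambda$ if $x\to y$ and $\mu$ otherwise; throughout it is assumed that $0<t<k$. For $X\subseteq A$, $\overline{X}=\sum_{x\in X}x$ in the group algebra $\mathbb{C}A$, and $f$ is extended linearly to $\mathbb{C}A$; products are taken in $\mathbb{C}A$.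
   Formalization: The formal theorem assumes in addition that X is nonempty: for X = Y = ∅ one has B = A and (i)–(iii) hold, but Γ has no arcs, so it is not a DSRG under the standing assumption 0 < t < k and the equivalence fails. *)

(* Defs.v *)
From HB Require Import structures.
From mathcomp Require Import all_boot all_order all_algebra.
From mathcomp Require Import all_fingroup all_solvable all_character.
From mathcomp Require Import complex reals.

Set Implicit Arguments.
Unset Strict Implicit.
Unset Printing Implicit Defensive.

Import GRing.Theory.

(* The parameters are listed in the order (N, k, mu, lambda, t), and the
   non-degeneracy condition 0 < t < k is part of the definition. *)
Definition dsrg_with (V : finType) (arc : rel V) (N k mu lambda t : nat) : Prop :=
  [/\ #|V| = N,
      (forall x, ~~ arc x x),
      (forall x, #|[set y | arc x y]| = k /\ #|[set y | arc y x]| = k),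
      (forall x, #|[set z | arc x z && arc z x]| = t) &
      (forall x y, x != y ->
         #|[set z | arc x z && arc z y]| = if arc x y then lambda else mu)]
  /\ 0 < t < k.

Definition is_dsrg (V : finType) (arc : rel V) : Prop :=
  exists N k mu lambda t, dsrg_with arc N k mu lambda t.

Definition cayley (gT : finGroupType) (S : {set gT}) : rel gT :=
  fun x y => (y * x^-1)%g \in S.

Definition union_of_cosets (gT : finGroupType) (B A X : {set gT}) : Prop :=
  exists2 P : {set {set gT}}, P \subset rcosets B A & X = cover P.

Section GroupAlgebra.

Variables (F : fieldType) (gT : finGroupType) (A : {group gT}).

(* The group algebra F[A] is MathComp's [group_ring F A], whose elements are the
   matrices spanned by the [regular_repr F A x], x in A, with product [*m]; the
   sum of a subset X of A is [gset_mx F A X]. The coefficient of x in M is the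
   entry [gring_row M 0 (gring_index A x)]. *)
Definition gring_lin (h : gT -> gT) (M : 'M[F]_(gcard A)) : 'M[F]_(gcard A) :=
  (\sum_(x in A)
     gring_row M 0 (gring_index A x) *: regular_repr F A (h x))%R.

Lemma gring_lin_is_linear h : linear (gring_lin h).
Proof.
move=> a M N; rewrite /gring_lin scaler_sumr -big_split /=.
by apply: eq_bigr => x _; rewrite linearP !mxE scalerDl scalerA.
Qed.

Lemma gring_linE h x :
  x \in A -> gring_lin h (regular_repr F A x) = regular_repr F A (h x).
Proof.
move=> Ax; rewrite /gring_lin (bigD1 x) //= big1 => [|y /andP[Ay nyx]].
  by rewrite addr0 /gring_row !(rowK, mxE) gring_indexK // mul1g !eqxx scale1r.
rewrite /gring_row !(rowK, mxE) gring_indexK // mul1g eqxx /=.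
rewrite (can_in_eq (@gring_indexK _ A)) //.
by rewrite (negPf nyx) scale0r.
Qed.

End GroupAlgebra.

(* Main.v *)
Require Import Defs.
From HB Require Import structures.
From mathcomp Require Import all_boot all_order all_algebra.
From mathcomp Require Import all_fingroup all_solvable all_character all_field.
From mathcomp Require Import complex reals.
From mathcomp Require Import zify ring.

(* The arcs of the Cayley graph are governed by the numbers of ways to write an
   element of A as a product of elements of X, f X, Y and f Y. Comparing total
   counts gives t = mu. With d = lambda - mu, the two counting equations force
   chi(X) + chi(f X) to be 0, d or 2d for each nontrivial character chi of A, so
   chi(B) is 0, -d or -2d. Fourier inversion at 1 excludes d >= 0; hence all
   chi(B) are nonnegative, i.e. the indicator of B is positive definite with
   value 1 at 1, and the set where such a function equals 1 is a subgroup. After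
   that, everything follows by counting inside cosets of B. *)

Set Implicit Arguments.
Unset Strict Implicit.
Unset Printing Implicit Defensive.

Import GRing.Theory Num.Theory Order.TTheory.
Local Open Scope group_scope.

(** The coefficient of [g] in the group-algebra product of the sums of [W] and [U]: each [u]
    determines its cofactor [w] in [g = w * u]. *)
Definition conv_count (gT : finGroupType) (U W : {set gT}) (g : gT) : nat :=
  #|[set u in U | g * u^-1 \in W]|.

(** * Convolution counts and products in the group algebra *)

Section Convolution.

Variables (gT : finGroupType) (A : {group gT}).
Implicit Types (U W : {set gT}) (g : gT).

Lemma conv_countE U W g :
  conv_count U W g = (\sum_(u in U) (g * u^-1 \in W)%g)%N.
Proof. by rewrite /conv_count -sum1dep_card big_mkcondr. Qed.

(** Values in an arbitrary [nmodType] let one identity serve twice: with the regular representation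
    for products in the group algebra, and with multiplicative functions for the Fourier
    equations. *)
Lemma sum_conv_count (V : nmodType) (F : gT -> V) U W :
    U \subset A -> W \subset A ->
  (\sum_(g in A) F g *+ conv_count U W g
    = \sum_(u in U) \sum_(w in W) F (w * u)%g)%R.
Proof.
move=> sUA sWA.
transitivity (\sum_(g in A) \sum_(u in U) F g *+ (g * u^-1 \in W)%g)%R.
  by apply: eq_bigr => g _; rewrite conv_countE -sumrMnr.
rewrite exchange_big /=; apply: eq_bigr => u Uu.
rewrite (reindex_inj (mulIg u)) /=.
transitivity (\sum_(w in A) F (w * u)%g *+ (w \in W))%R.
  apply: eq_big => [w | w _]; last by rewrite mulgK.
  by rewrite groupMr // (subsetP sUA).
rewrite (big_setID W) /= (setIidPr sWA) [X in (_ + X)%R]big1 ?addr0.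
  by apply: eq_bigr => w ->.
by move=> w /setDP[_ /negPf->].
Qed.

Lemma sum_conv_count_mul (R : comPzRingType) (phi : gT -> R) U W :
    {in A &, {morph phi : x y / x * y >-> (x * y)%R}} ->
    U \subset A -> W \subset A ->
  (\sum_(g in A) phi g *+ conv_count U W g
    = (\sum_(u in U) phi u) * (\sum_(w in W) phi w))%R.
Proof.
move=> phiM sUA sWA; rewrite sum_conv_count // mulr_suml.
apply: eq_bigr => u Uu; rewrite mulr_sumr; apply: eq_bigr => w Ww.
have [Aw Au] := (subsetP sWA w Ww, subsetP sUA u Uu).
by rewrite phiM // mulrC.
Qed.

Lemma conv_countU U1 U2 W g : U1 :&: U2 = set0 ->
  conv_count (U1 :|: U2) W g = (conv_count U1 W g + conv_count U2 W g)%N.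
Proof.
move=> U120; rewrite /conv_count -cardsUI [X in (_ + X)%N]eq_card0 ?addn0.
  by apply: eq_card => u; rewrite !inE andb_orl.
move=> u; have := in_set0 u; rewrite -U120 !inE.
by case: (u \in U1); case: (u \in U2); rewrite ?andbF.
Qed.

Lemma conv_count_rcoset U W x g :
  conv_count (U :* x) W g = conv_count U W (g * x^-1).
Proof.
rewrite /conv_count -[RHS](card_rcoset _ x); apply: eq_card => z.
by rewrite mem_rcoset !inE mem_rcoset invMg invgK -mulgA mulKg.
Qed.

(** The injection [u |-> g * u^-1] swaps the two factors when [A] is abelian; one inequality for all
    pairs of sets gives the equality. *)
Lemma conv_countC U W g : abelian A -> U \subset A -> W \subset A -> g \in A ->
  conv_count U W g = conv_count W U g.
Proof.
move=> cAA.
have le U' W' : U' \subset A -> W' \subset A -> g \in A ->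
    (conv_count U' W' g <= conv_count W' U' g)%N.
  move=> sUA sWA Ag; rewrite /conv_count.
  have injg : injective (fun u : gT => g * u^-1).
    by move=> u v /mulgI/invg_inj.
  rewrite -(card_imset _ injg); apply/subset_leq_card/subsetP.
  move=> v /imsetP[u uP ->].
  move: uP; rewrite !inE => /andP[Uu Wu]; rewrite Wu invMg invgK.
  have Au := subsetP sUA u Uu.
  by rewrite mulgA (centsP cAA g Ag u Au) mulgK.
by move=> sUA sWA Ag; apply/eqP; rewrite eqn_leq !le.
Qed.

(** With the left set enlarged to all of [A], every [w] in [W] has exactly one cofactor, namely
    [w^-1 * g]. *)
Lemma conv_countDl U W g : U \subset A -> W \subset A -> g \in A ->
  (conv_count (A :\: U) W g + conv_count U W g = #|W|)%N.
Proof.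
move=> sUA sWA Ag; rewrite addnC -conv_countU; last first.
  by rewrite setDE setICA setICr setI0.
rewrite -{1}(setIidPr sUA) setID /conv_count.
have inv_inj : injective (fun u : gT => g * u^-1) by move=> u v /mulgI/invg_inj.
rewrite -(card_imset _ inv_inj); apply: eq_card => w.
apply/imsetP/idP => [[u] | Ww]; first by rewrite inE => /andP[_ Wu] ->.
exists (w^-1 * g); last by rewrite invMg invgK mulgA mulgV mul1g.
have Aw := subsetP sWA w Ww.
by rewrite inE groupM ?groupV //= invMg invgK mulKVg.
Qed.

Lemma gset_mx_mulE (F : fieldType) U W : U \subset A -> W \subset A ->
  (gset_mx F A W *m gset_mx F A U
    = \sum_(g in A) regular_repr F A g *+ conv_count U W g)%R.
Proof.
move=> sUA sWA; rewrite sum_conv_count // /gset_mx mulmx_sumr.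
apply: eq_bigr => u Uu; rewrite mulmx_suml; apply: eq_bigr => w Ww.
have [Aw Au] := (subsetP sWA w Ww, subsetP sUA u Uu).
by rewrite repr_mxM.
Qed.

(** The matrices of the regular representation are linearly independent, so products agree iff their
    coefficients do; characteristic 0 recovers the natural numbers. *)
Lemma gset_mx_mul_eq (F : numFieldType) (U W U' W' : {set gT}) :
    U \subset A -> W \subset A -> U' \subset A -> W' \subset A ->
  (gset_mx F A W *m gset_mx F A U = gset_mx F A W' *m gset_mx F A U')%R
  <-> {in A, conv_count U W =1 conv_count U' W'}.
Proof.
move=> sUA sWA sUA' sWA'; rewrite !gset_mx_mulE //; split=> [eqUW g Ag|eqUW].
  (* [gring_proj g] reads off the coefficient of [g]. *)
  have projE c : (gring_proj g (\sum_(h in A) regular_repr F A h *+ c h)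
      = (c g)%:R :> 'M_1)%R.
    rewrite linear_sum (bigD1 g) //= big1 ?addr0 => [|h /andP[Ah ne_hg]].
      by rewrite raddfMn /= gring_projE // eqxx.
    by rewrite raddfMn /= gring_projE // eq_sym (negPf ne_hg) mul0rn.
  have := congr1 (fun M : 'M_(gcard A) => gring_proj g M ord0 ord0) eqUW.
  rewrite !projE !mulmxnE !mxE eqxx.
  by move/eqP; rewrite eqr_nat => /eqP.
by apply: eq_bigr => g Ag; rewrite eqUW.
Qed.

Lemma gring_lin_gset (F : fieldType) (h : {perm gT}) U : U \subset A ->
  gring_lin h (gset_mx F A U) = gset_mx F A (h @: U).
Proof.
move=> sUA; rewrite /gset_mx big_imset /=; last by move=> x y _ _ /perm_inj.
transitivity (\sum_(x in U) gring_lin (A := A) h (regular_repr F A x))%R.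
  pose L := GRing.isLinear.Build _ _ _ _ _ (@gring_lin_is_linear F gT A h).
  pose Lf : {linear _ -> _} := HB.pack (@gring_lin F gT A h) L.
  exact: (linear_sum Lf).
by apply: eq_bigr => x Ux; rewrite gring_linE ?(subsetP sUA).
Qed.

End Convolution.

(** * Fourier inversion and positive definite indicators on an abelian group *)

Section PositiveDefinite.

Variables (gT : finGroupType) (A : {group gT}) (B : {set gT}).
Hypotheses (cAA : abelian A) (sBA : B \subset A).

Lemma irr_abelianM (i : Iirr A) :
  {in A &, {morph ('chi_i)%R : x y / x * y >-> (x * y)%R}}.
Proof. exact: lin_charM (char_abelianP _ cAA i). Qed.

Lemma irr_abelian1 (i : Iirr A) : ('chi_i 1%g = 1)%R.
Proof. exact: lin_char1 (char_abelianP _ cAA i). Qed.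

(** All irreducible characters are linear, so their sum at [x * g^-1] is the regular character,
    which is [#|A|] at [x = g] and 0 elsewhere. *)
Lemma fourier_inversion g : g \in A ->
  (\sum_i (\sum_(x in B) 'chi[A]_i x) * 'chi_i g^-1%g
    = #|A|%:R *+ (g \in B))%R.
Proof.
move=> Ag; transitivity (\sum_(x in B) cfReg A (x * g^-1)%g)%R.
  rewrite (eq_bigr (fun i => \sum_(x in B) 'chi[A]_i (x * g^-1)%g))%R.
    rewrite exchange_big; apply: eq_bigr => x Bx.
    rewrite cfReg_sum sum_cfunE; apply: eq_bigr => i _.
    by rewrite cfunE irr_abelian1 mul1r.
  move=> i _; rewrite mulr_suml; apply: eq_bigr => x Bx.
  by rewrite irr_abelianM ?groupV // (subsetP sBA).
under eq_bigr => x _ do rewrite cfRegE -eq_mulgV1.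
case: (boolP (g \in B)) => Bg.
  rewrite (bigD1 g) //= eqxx big1 ?addr0 // => x /andP[_ /negPf->].
  by rewrite mulr0n.
by rewrite big1 // => x Bx; case: eqP Bg => // <-; rewrite Bx.
Qed.

(** For [g] in [B], inversion at [g] and at 1 gives the same value [#|A|]. With nonnegative
    coefficients this is equality in the triangle inequality, so ['chi_i g^-1] is 1 wherever the
    coefficient is nonzero, a condition closed under products. *)
Lemma irr_sum_pos_group : 1 \in B ->
  (forall i, 0 <= \sum_(x in B) 'chi[A]_i x)%R -> group_set B.
Proof.
move=> mem1_B pos; set c := fun i => (\sum_(x in B) 'chi[A]_i x)%R in pos.
have sum_c : (\sum_i c i = #|A|%:R)%R.
  have := @fourier_inversion 1 (group1 A); rewrite mem1_B mulr1n => <-.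
  by apply: eq_bigr => i _; rewrite invg1 irr_abelian1 mulr1.
have norm_chi i g : g \in A -> (`|'chi[A]_i g| = 1)%R.
  by move=> Ag; apply: normC_lin_char => //; apply/char_abelianP.
have chiB g i : g \in B -> (c i * 'chi_i g^-1%g = c i)%R.
  move=> Bg; have Ag := subsetP sBA g Bg; move: i.
  suff /(_ _ isT) // : forall i, true -> (c i * 'chi_i g^-1%g = c i)%R by [].
  apply: normC_sum_upper => [i _|].
    by rewrite normrM norm_chi ?groupV // mulr1 ger0_norm ?pos.
  by rewrite fourier_inversion // Bg sum_c.
apply/group_setP; split=> // g h Bg Bh.
have [Ag Ah] := (subsetP sBA g Bg, subsetP sBA h Bh).
(* If [g * h] were outside [B], inversion would give 0, whereas the left side collapses to the sum
   of the [c i], which is [#|A|]. *)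
have := fourier_inversion (groupM Ag Ah); case: (_ \in B) => //.
under eq_bigr => i _ do
  rewrite invMg irr_abelianM ?groupV // mulrA (chiB h i) // (chiB g i) //.
move/eqP; rewrite sum_c mulr0n pnatr_eq0 => /eqP A0.
by have := cardG_gt0 A; rewrite A0.
Qed.

End PositiveDefinite.

(** * Unions of cosets and convolution with a subgroup *)

Section CosetUnions.

Variables (gT : finGroupType) (A H : {group gT}) (U : {set gT}).
Hypotheses (cAA : abelian A) (sHA : H \subset A) (sUA : U \subset A).

Lemma union_of_cosetsP :
  union_of_cosets H A U <-> {in H & U, forall h u, h * u \in U}.
Proof.
split=> [[P sP ->] h u Hh /bigcupP[C PC Cu] | stabU].
  apply/bigcupP; exists C => //.
  have /rcosetsP[x _ defC] := subsetP sP C PC.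
  by move: Cu; rewrite defC !mem_rcoset -(mulgA h) (groupMl _ Hh).
exists [set H :* u | u in U].
  apply/subsetP => C /imsetP[u Uu ->]; apply/rcosetsP.
  by exists u => //; apply: (subsetP sUA).
apply/setP => u; apply/idP/bigcupP => [Uu | [C /imsetP[v Uv ->]]].
  by exists (H :* u); [apply: imset_f | apply: rcoset_refl].
by case/rcosetP => h Hh ->; apply: stabU.
Qed.

Lemma conv_count_coset g : g \in A -> conv_count H U g = #|U :&: H :* g|.
Proof.
move=> Ag; have inj_g : injective (fun u : gT => g * u^-1).
  by move=> u v /mulgI/invg_inj.
rewrite /conv_count -(card_imset _ inj_g); apply: eq_card => w.
rewrite in_setI mem_rcoset.
apply/imsetP/andP => [[u uP ->] | [Uw Hw]].
  move: uP; rewrite inE => /andP[Hu ->]; have Au := subsetP sHA u Hu.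
  by rewrite (centsP cAA g Ag u^-1 (groupVr Au)) mulgK groupV.
have Aw := subsetP sUA w Uw.
have eq_w : g * (w^-1 * g)^-1 = w by rewrite invMg invgK mulKVg.
exists (w^-1 * g); last by rewrite eq_w.
rewrite inE eq_w Uw andbT (centsP cAA _ (groupVr Aw) g Ag).
by rewrite -groupV invMg invgK.
Qed.

(** A coset of [H] is either contained in [U] or disjoint from it, so its intersection with [U] has
    [#|H|] elements or none. *)
Lemma conv_count_stable g : {in H & U, forall h u, h * u \in U} -> g \in A ->
  conv_count H U g = ((g \in U) * #|H|)%N.
Proof.
move=> stabU Ag; rewrite conv_count_coset //.
case: (boolP (g \in U)) => Ug; rewrite ?mul1n ?mul0n.
  rewrite (setIidPr _) ?card_rcoset //.
  by apply/subsetP => w /rcosetP[h Hh ->]; apply: stabU.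
apply/eqP; rewrite cards_eq0; apply: contraR Ug => /set0Pn[w].
rewrite inE mem_rcoset => /andP[Uw Hw].
suff -> : g = (w * g^-1)^-1 * w by apply: stabU; rewrite ?groupV.
by rewrite invMg invgK mulgKV.
Qed.

Lemma conv_count_full g : g \in A -> (#|H| <= conv_count H U g)%N ->
  H :* g \subset U.
Proof.
move=> Ag; rewrite conv_count_coset // -(card_rcoset H g) => leHU.
apply/setIidPr/eqP.
by rewrite eqEcard subsetIr leHU.
Qed.

End CosetUnions.

(** * Degrees and 2-paths in a Cayley graph *)

Section CayleyCount.

Variables (gT : finGroupType) (S : {set gT}).

(** A path through [z] is the factorization of [y * x^-1] as [(y * z^-1) * (z * x^-1)]. *)
Lemma card_cayley_path (x y : gT) :
  #|[set z | cayley S x z && cayley S z y]| = conv_count S S (y * x^-1).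
Proof.
rewrite /conv_count -[RHS](card_rcoset _ x); apply: eq_card => z.
by rewrite mem_rcoset !inE /cayley invMg invgK mulgA mulgKV.
Qed.

Lemma card_cayley_out (x : gT) : #|[set y | cayley S x y]| = #|S|.
Proof.
by rewrite -(card_rcoset S x); apply: eq_card => y; rewrite inE mem_rcoset.
Qed.

Lemma card_cayley_in (x : gT) : #|[set y | cayley S y x]| = #|S|.
Proof.
have inj_x : injective (fun s => s^-1 * x) by move=> s u /mulIg/invg_inj.
rewrite -[RHS](card_imset _ inj_x); apply: eq_card => y; rewrite inE /cayley.
apply/idP/imsetP => [Sy | [s Ss ->]]; last by rewrite invMg invgK mulKVg.
by exists (x * y^-1) => //; rewrite invMg invgK mulgKV.
Qed.

End CayleyCount.

(** * Reduction of the counts in the whole group to counts in [A] *)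

Section IndexTwo.

Variables (gT : finGroupType) (A : {group gT}) (b : gT) (f : {perm gT}).
Variables (X Y : {set gT}).
Hypotheses (cAA : abelian A) (notAb : b \notin A).
Hypothesis (AbP : forall g, g \notin A -> g * b^-1 \in A).
Hypothesis Ab2 : b ^+ 2 \in A.
Hypothesis b_conj : forall a, a \in A -> b * a * b^-1 = f a.
Hypotheses (fAut : f \in Aut A) (fK : involutive f) (fb2 : f (b ^+ 2) = b ^+ 2).
Hypotheses (sXA : X \subset A) (X'1 : 1 \notin X) (sYA : Y \subset A).
Hypotheses (X_n0 : X != set0) (Xf : X :&: f @: X = set0).
Hypotheses (Yf : Y :&: f @: Y = set0) (cardXY : #|X| = #|Y|).

Let Z := X :|: f @: X.
Let B := A :\: Z.
Let S := X :|: Y :* b.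

Lemma mem_imset_invol (U : {set gT}) g : (g \in f @: U) = (f g \in U).
Proof. by rewrite -{1}[g]fK mem_imset //; apply: perm_inj. Qed.

Lemma f_closed g : g \in A -> f g \in A. Proof. exact: Aut_closed. Qed.

Lemma fM : {in A &, {morph f : x y / x * y}}.
Proof. exact: (morphicP (Aut_morphic fAut)). Qed.

Lemma fV : {in A, {morph f : x / x^-1}}.
Proof. by move=> x Ax; rewrite /= -!(autmE fAut) morphV. Qed.

Lemma sub_imset_aut (U : {set gT}) : U \subset A -> f @: U \subset A.
Proof.
move=> sUA; apply/subsetP => _ /imsetP[u Uu ->].
by rewrite f_closed ?(subsetP sUA).
Qed.

Lemma imset_aut_disjoint (U : {set gT}) g :
  U :&: f @: U = set0 -> g \in U -> f g \notin U.
Proof.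
by move=> Uf Ug; have := in_set0 g; rewrite -Uf inE Ug mem_imset_invol /= => ->.
Qed.

Lemma card_union_imset (U : {set gT}) :
  U :&: f @: U = set0 -> #|U :|: f @: U| = (2 * #|U|)%N.
Proof.
move=> Uf; rewrite cardsU Uf cards0 subn0 card_imset; last exact: perm_inj.
by rewrite mul2n addnn.
Qed.

Lemma sub_Z : Z \subset A.
Proof. by rewrite subUset sXA sub_imset_aut. Qed.

Lemma cardA_eq : #|A| = (2 * #|X| + #|B|)%N.
Proof.
rewrite -card_union_imset // -/Z cardsD (setIidPr sub_Z).
by rewrite subnKC ?subset_leq_card ?sub_Z.
Qed.

(** Used for the two fixed points 1 and [b ^+ 2]. *)
Lemma fixed_mem_B a : a \in A -> f a = a -> a \in B.
Proof.
move=> Aa fa; rewrite inE Aa andbT inE mem_imset_invol fa orbb.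
by apply/negP => Xa; have := imset_aut_disjoint Xf Xa; rewrite fa Xa.
Qed.

Lemma f_one : f 1 = 1. Proof. by rewrite -(autmE fAut) morph1. Qed.

Lemma mem1_B : 1 \in B.
Proof. by apply: fixed_mem_B; rewrite ?f_one. Qed.

Lemma conv_count_imset (U W : {set gT}) g : U \subset A -> g \in A ->
  conv_count (f @: U) (f @: W) (f g) = conv_count U W g.
Proof.
move=> sUA Ag; rewrite !conv_countE big_imset /=.
  apply: eq_bigr => u Uu; have Au := subsetP sUA u Uu.
  by rewrite -fV // -fM ?groupV // mem_imset_invol fK.
by move=> x y _ _ /perm_inj.
Qed.

Lemma mem_S a : a \in A -> (a \in S) = (a \in X).
Proof.
move=> Aa; rewrite inE mem_rcoset; case: (boolP (a * b^-1 \in Y)) => [Yab|_].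
  have := subsetP sYA _ Yab.
  by rewrite groupMl // groupV (negPf notAb).
by rewrite orbF.
Qed.

Lemma mem_Sb a : a \in A -> (a * b \in S) = (a \in Y).
Proof.
move=> Aa; rewrite inE mem_rcoset mulgK; case: (boolP (a * b \in X)) => // Xab.
by have := subsetP sXA _ Xab; rewrite groupMl // (negPf notAb).
Qed.

Lemma disjoint_S : X :&: Y :* b = set0.
Proof.
apply/setP => a; rewrite inE in_set0 mem_rcoset.
apply/negP => /andP[/(subsetP sXA) Aa /(subsetP sYA)].
by rewrite groupMl // groupV (negPf notAb).
Qed.

Lemma card_S : #|S| = (2 * #|X|)%N.
Proof.
by rewrite cardsU disjoint_S cards0 subn0 card_rcoset -cardXY mul2n addnn.
Qed.

(** Both factors lie in [X] or both in [Y :* b]; in the second case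
    [(w * b) * (y * b) = w * f y * b ^+ 2]. *)
Lemma conv_count_S g : g \in A -> conv_count S S g =
  (conv_count X X g + conv_count (f @: Y) Y (g * (b ^+ 2)^-1))%N.
Proof.
move=> Ag; rewrite conv_countU ?disjoint_S //; congr addn; rewrite !conv_countE.
  apply: eq_bigr => u Uu; have Au := subsetP sXA u Uu.
  by rewrite mem_S // groupM ?groupV.
rewrite -!conv_countE conv_count_rcoset !conv_countE big_imset /=; last first.
  by move=> x y _ _ /perm_inj.
apply: eq_bigr => y Yy; have Ay := subsetP sYA y Yy.
have -> : g * b^-1 * y^-1 = g * (b ^+ 2)^-1 * (f y)^-1 * b.
  by rewrite -b_conj // !invMg invgK !mulgA !mulgKV.
by rewrite mem_Sb // !groupM ?groupV ?f_closed.
Qed.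

(** Exactly one factor lies in [Y :* b]. Moving [b] to the right past [x] turns [x] into [f x], so
    the two orders contribute [X] and [f @: X], together [Z]. *)
Lemma conv_count_Sb a : a \in A -> conv_count S S (a * b) = conv_count Z Y a.
Proof.
move=> Aa; rewrite !conv_countU ?disjoint_S // addnC; congr addn.
  rewrite [RHS](conv_countC cAA) // conv_count_rcoset mulgK !conv_countE.
  apply: eq_bigr => y Yy; have Ay := subsetP sYA y Yy.
  by rewrite mem_S // groupM ?groupV.
rewrite !conv_countE big_imset /=; last by move=> x y _ _ /perm_inj.
apply: eq_bigr => x Xx; have Ax := subsetP sXA x Xx.
have -> : a * b * x^-1 = a * (f x)^-1 * b.
  by rewrite -b_conj // !invMg invgK !mulgA mulgKV.
by rewrite mem_Sb // groupM ?groupV ?f_closed.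
Qed.

Section SubgroupB.

Variable H : {group gT}.
Hypothesis HB : H = B :> {set gT}.

Lemma sub_H : H \subset A. Proof. by rewrite HB subsetDl. Qed.

Lemma fH h : h \in H -> f h \in H.
Proof.
rewrite HB !inE !mem_imset_invol fK orbC => /andP[-> Ah]; exact: f_closed.
Qed.

Lemma imset_invol (U : {set gT}) : f @: (f @: U) = U.
Proof. by apply/setP => g; rewrite !mem_imset_invol fK. Qed.

(** [A] is the disjoint union of [X], [f @: X] and [H]. *)
Lemma conv_count_partition (U : {set gT}) g : U \subset A -> g \in A ->
  (conv_count X U g + conv_count (f @: X) U g + conv_count H U g = #|U|)%N.
Proof.
move=> sUA Ag; rewrite -conv_countU // HB addnC.
exact: conv_countDl sub_Z sUA Ag.
Qed.

Lemma conv_count_partitionY g : g \in A ->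
  (conv_count Z Y g + conv_count H Y g = #|Y|)%N.
Proof. by move=> Ag; rewrite /Z conv_countU // conv_count_partition. Qed.

(* A fixed point of f lies neither in X nor in f X, so alpha = b^2 is in B and
   drops out of the counting equations once Y is a union of B-cosets. *)
Lemma conv_count_alpha g : {in H & Y, forall h u, h * u \in Y} -> g \in A ->
  conv_count (f @: Y) Y (g * (b ^+ 2)^-1) = conv_count (f @: Y) Y g.
Proof.
move=> stabY Ag; have Hb2 : b ^+ 2 \in H by rewrite HB fixed_mem_B.
rewrite !conv_countE; apply: eq_bigr => u /(subsetP (sub_imset_aut sYA)) Au.
have -> : g * (b ^+ 2)^-1 * u^-1 = (b ^+ 2)^-1 * (g * u^-1).
  by rewrite (centsP cAA g Ag _ (groupVr Ab2)) mulgA.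
congr nat_of_bool; apply/idP/idP => [Yg | Yg]; last by rewrite stabY ?groupV.
by rewrite -(mulKVg (b ^+ 2) (g * u^-1)) stabY.
Qed.

End SubgroupB.

(** Path counts depend only on [y * x^-1], which lies in [A] or in [A :* b]; the two cases give the
    two counting equations. *)
Lemma dsrg_conv_countP N k mu la t :
  dsrg_with (cayley S) N k mu la t <->
  [/\ #|gT| = N, (2 * #|X|)%N = k, (0 < t < k)%N,
      {in A, forall g,
        (conv_count X X g + conv_count (f @: Y) Y (g * (b ^+ 2)^-1))%N
          = if g == 1 then t else if g \in X then la else mu} &
      {in A, forall a, conv_count Z Y a = if a \in Y then la else mu}].
Proof.
have ab_neq1 a : a \in A -> a * b != 1.
  by move=> Aa; apply: contraNneq notAb => ab1; rewrite -(groupMl _ Aa) ab1.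
split=> [[[cardV _ deg pathxx pathxy] ltk] | [cardV degk ltk E1 E2]].
  have [degk _] := deg 1; rewrite card_cayley_out card_S in degk.
  have path1 g : g != 1 -> conv_count S S g = if g \in S then la else mu.
    move=> g1; rewrite eq_sym in g1.
    by have := pathxy _ _ g1; rewrite card_cayley_path /cayley invg1 mulg1.
  split=> // [g Ag | a Aa].
    rewrite -conv_count_S //; case: eqP => [-> | /eqP g1].
      by have := pathxx 1; rewrite card_cayley_path mulgV.
    by rewrite path1 // mem_S.
  by rewrite -conv_count_Sb // path1 ?ab_neq1 // mem_Sb.
have S1 : 1 \notin S by rewrite mem_S.
split=> //; split=> // [x | x | x | x y ne_xy].
- by rewrite /cayley mulgV.
- by rewrite card_cayley_out card_cayley_in card_S.
- by rewrite card_cayley_path mulgV conv_count_S // E1 // eqxx.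
rewrite card_cayley_path /cayley; set g := y * x^-1.
have g1 : g != 1 by rewrite -eq_mulgV1 eq_sym.
have [Ag | /AbP Aa] := boolP (g \in A).
  by rewrite conv_count_S // E1 // (negPf g1) mem_S.
by rewrite -[g](mulgKV b) conv_count_Sb // E2 // mem_Sb.
Qed.

Lemma sum_Z (V : nmodType) (phi : gT -> V) :
  (\sum_(z in Z) phi z = \sum_(x in X) phi x + \sum_(x in X) phi (f x))%R.
Proof.
rewrite (eq_bigl [predU X & f @: X]) => [|z]; last by rewrite !inE.
rewrite bigU -?setI_eq0 ?Xf //= big_imset //=.
by move=> x y _ _ /perm_inj.
Qed.

Lemma sum_indicator (V : nmodType) (phi : gT -> V) (U : {set gT}) :
  U \subset A -> (\sum_(g in A) phi g *+ (g \in U) = \sum_(u in U) phi u)%R.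
Proof.
move=> sUA; rewrite (big_setID U) /= (setIidPr sUA) [X in (_ + X)%R]big1.
  by rewrite addr0; apply: eq_bigr => u ->.
by move=> g /setDP[_ /negPf->].
Qed.

(** * Character equations of a DSRG and the subgroup property of [B] *)

Section Forward.

Variables (la mu t : nat).
Hypothesis E1 : {in A, forall g,
  (conv_count X X g + conv_count (f @: Y) Y (g * (b ^+ 2)^-1))%N
    = if g == 1 then t else if g \in X then la else mu}.
Hypothesis E2 :
  {in A, forall a, conv_count Z Y a = if a \in Y then la else mu}.

Let d : algC := (la%:R - mu%:R)%R.

Section Fourier.

Variable phi : gT -> algC.
Hypothesis phiM : {in A &, {morph phi : x y / x * y >-> (x * y)%R}}.

(** The right side of [E1] is a combination of the indicators of 1, [X] and [A]; the equation is
    summed against [phi]. Keeping [phi] general allows the constant 1, a character, and a character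
    composed with [f]. *)
Lemma fourier_A :
  ((\sum_(x in X) phi x) ^+ 2
     + phi (b ^+ 2)%g * ((\sum_(y in Y) phi (f y)) * (\sum_(y in Y) phi y))
   = (t%:R - mu%:R) * phi 1%g + d * (\sum_(x in X) phi x)
       + mu%:R * \sum_(a in A) phi a)%R.
Proof.
transitivity (\sum_(g in A) phi g *+
  (conv_count X X g + conv_count (f @: Y) Y (g * (b ^+ 2)^-1)%g))%R.
  under [RHS]eq_bigr do rewrite mulrnDr.
  rewrite big_split /= sum_conv_count_mul //; congr (_ + _)%R.
  (* Translating by [b ^+ 2] turns the shift in the count into the factor [phi (b ^+ 2)]. *)
  rewrite [RHS](reindex_inj (mulIg (b ^+ 2))) /=.
  transitivity
    (\sum_(g in A) phi (b ^+ 2)%g * (phi g *+ conv_count (f @: Y) Y g))%R.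
    rewrite -mulr_sumr sum_conv_count_mul ?sub_imset_aut // big_imset //=.
    by move=> x y _ _ /perm_inj.
  apply: eq_big => [g | g Ag]; first by rewrite groupMr.
  by rewrite (phiM Ag Ab2) mulgK mulrnAr mulrC.
under eq_bigr => g Ag do rewrite E1 //.
have -> : phi 1%g = (\sum_(g in A) phi g *+ (g \in [set 1%g]))%R.
  by rewrite sum_indicator ?sub1set // big_set1.
rewrite -(sum_indicator _ sXA) !mulr_sumr -!big_split /=.
apply: eq_bigr => g Ag; rewrite in_set1 /d.
case: eqP => [-> | _]; first by rewrite (negPf X'1) /=; ring.
by case: ifP => _ /=; ring.
Qed.

Lemma fourier_Ab :
  ((\sum_(x in X) phi x + \sum_(x in X) phi (f x)) * (\sum_(y in Y) phi y)
   = d * (\sum_(y in Y) phi y) + mu%:R * \sum_(a in A) phi a)%R.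
Proof.
transitivity (\sum_(g in A) phi g *+ conv_count Z Y g)%R.
  rewrite sum_conv_count_mul ?sub_Z //; congr (_ * _)%R.
  by rewrite sum_Z.
under eq_bigr => g Ag do rewrite E2 //.
rewrite -(sum_indicator _ sYA) !mulr_sumr -!big_split /=.
by apply: eq_bigr => g Ag; rewrite /d; case: ifP => _ /=; ring.
Qed.

End Fourier.

(** For [phi = 1] and [m = #|X| = #|Y|], both left sides equal [2 * m ^ 2], and the right sides
    differ only by [t - mu]. *)
Lemma dsrg_t_eq_mu : t = mu.
Proof.
have M1 : {in A &, {morph (fun _ => 1%R : algC) : x y / x * y >-> (x * y)%R}}.
  by move=> x y _ _; rewrite mulr1.
have := fourier_A M1; have := fourier_Ab M1; rewrite !sumr_const -cardXY.
set m : algC := (1 *+ #|X|)%R; move=> e2 e1.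
have /eqP : (t%:R - mu%:R = 0 :> algC)%R.
  suff -> : (t%:R - mu%:R = (1 * (m * m) + m ^+ 2) - (m + m) * m :> algC)%R.
    by ring.
  by rewrite e2 [(_ + m ^+ 2)%R]addrC e1; ring.
by rewrite subr_eq0 eqr_nat => /eqP.
Qed.

(** Let [x, x', y] be the sums of the character over [X], [f @: X], [Y]. If [x + x'] is not [d], the
    second equation forces [y = 0]; then [x] and [x'] are both roots of [z ^ 2 = d * z], must
    coincide, and so are both 0 or both [d]. The sum over [B] is [-(x + x')]. *)
Lemma irr_sum_B (i : Iirr A) : i != 0%R ->
  let c := (\sum_(x in B) 'chi_i x)%R in
  [\/ c = 0%R, c = (- d)%R | c = (- (d + d))%R].
Proof.
move=> i0 c; have chiM := irr_abelianM cAA i.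
have chifM :
  {in A &, {morph (fun g => 'chi_i (f g))%R : x y / x * y >-> (x * y)%R}}.
  by move=> x y Ax Ay; rewrite /= fM // chiM ?f_closed.
have sum0 : (\sum_(a in A) 'chi_i a = 0)%R.
  (* The sum over [A] vanishes by orthogonality to the trivial character, indexed by 0; scaling by
     the inverse of [#|A|] matches the form of that relation. *)
  have nzA : (#|A|%:R != 0 :> algC)%R by rewrite pnatr_eq0 -lt0n.
  rewrite -[LHS](mulVKf nzA) -[RHS](mulr0 #|A|%:R%R); congr (_ * _)%R.
  have := first_orthogonality_relation i 0%R.
  rewrite (negPf i0) mulr0n => {2}<-.
  congr (_ * _)%R; apply: eq_bigr => x Ax.
  by rewrite irr0 cfun1E groupV Ax mulr1.
have sumf0 : (\sum_(a in A) 'chi_i (f a) = 0)%R.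
  rewrite -[RHS]sum0 [RHS](reindex_inj (@perm_inj _ f)) /=; apply: eq_bigl => a.
  by apply/idP/idP => /f_closed; rewrite ?fK.
have := fourier_A chiM; have := fourier_Ab chiM.
have := fourier_A chifM.
rewrite sum0 sumf0 fb2 dsrg_t_eq_mu subrr !mul0r !mulr0 !add0r !addr0.
have -> : c = (- (\sum_(x in X) 'chi_i x + \sum_(x in X) 'chi_i (f x)))%R.
  apply/eqP; rewrite -addr_eq0 -sum_Z; apply/eqP; rewrite -[RHS]sum0.
  by rewrite [RHS](big_setID Z) /= (setIidPr sub_Z) addrC.
(* Composing the character with [f] exchanges [x] with [x'] and the two sums over [Y], since [f] is
   an involution. *)
under [X in (_ * (X * _))%R]eq_bigr do rewrite fK.
set x := (\sum_(x in X) 'chi_i x)%R; set x' := (\sum_(x in X) 'chi_i (f x))%R.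
set y := (\sum_(y in Y) 'chi_i y)%R; set y' := (\sum_(y in Y) 'chi_i (f y))%R.
move=> e3 e2 e1.
have [-> | ne_d] := eqVneq (x + x')%R d; first by constructor 2.
have y0 : y = 0%R.
  have nz : (x + x' - d != 0)%R by rewrite subr_eq0.
  apply/eqP; rewrite -(mulrI_eq0 _ (mulfI nz)).
  by rewrite mulrBl e2 subrr.
rewrite y0 !(mulr0, mul0r, addr0) in e1 e3.
have /eqP : ((x - x') * (x + x' - d) = 0)%R.
  suff -> : ((x - x') * (x + x' - d) = (x ^+ 2 - d * x) - (x' ^+ 2 - d * x'))%R.
    by rewrite e1 e3; ring.
  by ring.
rewrite mulf_eq0 !subr_eq0 (negPf ne_d) orbF => /eqP eq_x; rewrite -eq_x.
have /eqP : (x * (x - d) = 0)%R by rewrite mulrBr -expr2 e1; ring.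
rewrite mulf_eq0 subr_eq0 => /orP[] /eqP ->; first by constructor 1; ring.
by constructor 3.
Qed.

(** If [d >= 0], every nontrivial coefficient is at most 0, so inversion at 1 bounds [#|A|] by the
    trivial coefficient [#|B|], which is impossible for nonempty [X]. *)
Lemma dsrg_la_lt_mu : (la < mu)%N.
Proof.
rewrite ltnNge; apply/negP => le_mu_la.
have d_ge0 : (0 <= d)%R by rewrite subr_ge0 ler_nat.
have := fourier_inversion cAA (subsetDl A Z) (group1 A).
rewrite -/B mem1_B mulr1n.
under eq_bigr do rewrite invg1 irr_abelian1 // mulr1.
rewrite (bigD1 0%R) //= => sumE.
have : ((#|A|%:R : algC) <= #|B|%:R)%R.
  rewrite -sumE -[leRHS]addr0; apply: lerD.
    rewrite (eq_bigr (fun _ => 1%R)) ?sumr_const // => x /setDP[Ax _].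
    by rewrite irr0 cfun1E Ax.
  apply: sumr_le0 => i /irr_sum_B[] ->; rewrite ?oppr_le0 //.
  exact: addr_ge0.
rewrite ler_nat cardA_eq; move: X_n0; rewrite -card_gt0; clear; lia.
Qed.

Lemma dsrg_group_set_B : group_set B.
Proof.
apply: (irr_sum_pos_group cAA (subsetDl A Z) mem1_B) => i.
have d_le0 : (d <= 0)%R by rewrite subr_le0 ler_nat ltnW ?dsrg_la_lt_mu.
have [-> | /irr_sum_B[] ->] := eqVneq i 0%R; rewrite ?oppr_ge0 //.
  apply: sumr_ge0 => x /setDP[Ax _].
  by rewrite irr0 cfun1E Ax.
by rewrite -[0%R]addr0 lerD.
Qed.

(** * Necessity: counting inside cosets of [B] *)

Section Necessity.

Variable H : {group gT}.
Hypothesis HB : H = B :> {set gT}.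

Let stable (U : {set gT}) := {in H & U, forall h u, h * u \in U}.

(** [y] and [h * y] share a coset of [H], hence have the same count with [Z]. If only one of them
    were in [Y], [E2] would give [la = mu]. *)
Lemma dsrg_Y_stable : stable Y.
Proof.
move=> h y Hh Yy; have Ay := subsetP sYA y Yy.
have Ah : h \in A by apply: (subsetP (sub_H HB)).
apply: contraTT dsrg_la_lt_mu => Y'hy; rewrite -leqNgt.
have := conv_count_partitionY HB (groupM Ah Ay).
have := conv_count_partitionY HB Ay.
rewrite !(conv_count_coset cAA (sub_H HB)) ?groupM // rcosetM (rcoset_id Hh).
by rewrite !E2 ?groupM // Yy (negPf Y'hy) => <- /addIn->.
Qed.

(** [E2] is evaluated once inside [Y] and once outside; an outside point exists because
    [#|Y| = #|X| < #|A|]. *)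
Lemma dsrg_la_mu_eq : (la + #|H| = #|X|)%N /\ mu = #|X|.
Proof.
have stabY := dsrg_Y_stable.
have BYE g (Ag : g \in A) := conv_count_stable cAA (sub_H HB) sYA stabY Ag.
split.
  have /set0Pn[y Yy] : Y != set0 by rewrite -card_gt0 -cardXY card_gt0.
  have Ay := subsetP sYA y Yy.
  by have := conv_count_partitionY HB Ay; rewrite E2 // BYE // Yy mul1n cardXY.
have /subsetPn[a Aa Y'a] : ~~ (A \subset Y).
  apply/negP => /subset_leq_card.
  rewrite cardA_eq -cardXY; move: X_n0; rewrite -card_gt0; clear; lia.
have := conv_count_partitionY HB Aa.
by rewrite E2 // BYE // (negPf Y'a) mul0n addn0 cardXY.
Qed.

Lemma dsrg_countXX g : g \in A ->
  (conv_count X X g + conv_count (f @: Y) Y g + (g \in X) * #|H| = #|X|)%N.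
Proof.
move=> Ag; have [laE muE] := dsrg_la_mu_eq.
have := E1 Ag; rewrite (conv_count_alpha HB dsrg_Y_stable) //.
move=> ->; rewrite dsrg_t_eq_mu muE -laE.
case: eqP => [-> | _]; first by rewrite (negPf X'1); clear; lia.
by case: ifP => _; clear; lia.
Qed.

(** For [g] in [X], [f g] is not in [X]; comparing the equation at [g] and at [f g] shows that [g]
    has [#|H|] more factorizations over [f @: X] twice than over [X] twice. The partition identities
    for [X] and [f @: X] then force [conv_count H X g] to be at least [#|H|], so the whole coset
    lies in [X]. *)
Lemma dsrg_X_stable : stable X.
Proof.
move=> h g Hh Xg; have Ag := subsetP sXA g Xg.
suff sHgX : H :* g \subset X by apply: (subsetP sHgX); rewrite mem_rcoset mulgK.
apply: (conv_count_full cAA (sub_H HB) sXA Ag).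
have fX'g : f g \notin X := imset_aut_disjoint Xf Xg.
have := dsrg_countXX Ag; have := dsrg_countXX (f_closed Ag).
rewrite Xg (negPf fX'g) -(conv_count_imset X sXA (f_closed Ag)) fK.
rewrite -(conv_count_imset Y (sub_imset_aut sYA) (f_closed Ag)) fK imset_invol.
rewrite (conv_countC cAA sYA (sub_imset_aut sYA) Ag).
have := conv_count_partition HB sXA Ag.
have := conv_count_partition HB (sub_imset_aut sXA) Ag.
rewrite (conv_countC cAA sXA (sub_imset_aut sXA) Ag) (card_imset _ perm_inj).
by clear; lia.
Qed.

(** The complement of [W] is stable under [H] and has [#|H|] elements, so it is one coset, and it is
    [f]-invariant. It remains to see that this coset is [H] itself. *)
Lemma dsrg_Y_cover : X :|: f @: X = Y :|: f @: Y.
Proof.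
set W := Y :|: f @: Y; have stabY := dsrg_Y_stable.
have stabX := dsrg_X_stable.
have sWA : W \subset A by rewrite subUset sYA sub_imset_aut.
have fW g : (f g \in W) = (g \in W) by rewrite !inE !mem_imset_invol fK orbC.
have stabW' h g : h \in H -> g \in A :\: W -> h * g \in A :\: W.
  move=> Hh /setDP[Ag W'g]; have Ah := subsetP (sub_H HB) h Hh.
  rewrite inE groupM // andbT; apply: contra W'g.
  have eqg : g = h^-1 * (h * g) by rewrite mulKg.
  rewrite !inE !mem_imset_invol => /orP[Yhg | Yfhg].
    by apply/orP; left; rewrite eqg stabY ?groupV.
  apply/orP; right; rewrite eqg fM ?groupM ?groupV // stabY //.
  by rewrite (fH HB) ?groupV.
have cardW' : #|A :\: W| = #|H|.
  rewrite cardsD (setIidPr sWA) card_union_imset // HB cardA_eq -cardXY.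
  by clear; lia.
have /card_gt0P[g W'g] : (0 < #|A :\: W|)%N by rewrite cardW' cardG_gt0.
have defW' : H :* g = A :\: W.
  apply/eqP; rewrite eqEcard card_rcoset cardW' leqnn andbT.
  by apply/subsetP => w /rcosetP[h Hh ->]; apply: stabW'.
have /setDP[Ag _] := W'g.
have /rcosetP[h Hh fg] : f g \in H :* g.
  by move: W'g; rewrite defW' !in_setD fW => /andP[-> /f_closed].
(* Since [f g] lies in the coset of [g] and [X] is a union of cosets, [g] and [f g] are both in [X]
   or both outside; the former contradicts [Xf]. *)
have Hg : g \in H.
  have X_fX : (g \in X) = (f g \in X).
    rewrite fg; apply/idP/idP => [Xg | Xhg]; first exact: stabX.
    by rewrite -(mulKg h g) stabX ?groupV.
  rewrite HB !inE Ag mem_imset_invol -X_fX orbb andbT; apply/negP => Xg.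
  by have := imset_aut_disjoint Xf Xg; rewrite -X_fX Xg.
have : A :\: W = A :\: Z by rewrite -defW' rcoset_id // HB.
move/(congr1 (fun U => A :\: U)).
by rewrite !setDDr !setDv !set0U (setIidPr sWA) (setIidPr sub_Z).
Qed.

(** The counting equation and the partition identity for [X] have the same total and share all other
    terms, once [conv_count H X g] is [#|H|] on [X] and 0 off it. *)
Lemma dsrg_conv_eq : {in A, conv_count (f @: X) X =1 conv_count (f @: Y) Y}.
Proof.
move=> g Ag; have := conv_count_partition HB sXA Ag; have := dsrg_countXX Ag.
rewrite (conv_count_stable cAA (sub_H HB) sXA dsrg_X_stable Ag).
by clear; lia.
Qed.

End Necessity.

End Forward.

(** * Sufficiency: the counting equations from the coset structure *)

Section Sufficiency.

Variable H : {group gT}.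
Hypothesis HB : H = B :> {set gT}.
Hypothesis stabX : {in H & X, forall h u, h * u \in X}.
Hypothesis stabY : {in H & Y, forall h u, h * u \in Y}.
Hypothesis conv_eq : {in A, conv_count (f @: X) X =1 conv_count (f @: Y) Y}.

(** Ensures that the natural subtraction [#|X| - #|H|] is not truncated. *)
Lemma leq_card_stable : (#|H| <= #|X|)%N.
Proof.
have /set0Pn[x Xx] := X_n0; rewrite -(card_rcoset H x) subset_leq_card //.
by apply/subsetP => w /rcosetP[h Hh ->]; apply: stabX.
Qed.

(** [conv_eq] replaces the [Y] term of the first equation by the matching [X] term, and both
    equations become partition identities. *)
Lemma dsrg_sufficient :
  dsrg_with (cayley S) (#|gT|) (2 * #|X|) #|X| (#|X| - #|H|) #|X|.
Proof.
have leHX := leq_card_stable; have X_gt0 : (0 < #|X|)%N by rewrite card_gt0.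
apply/dsrg_conv_countP; split=> // [|g Ag | a Aa]; first by lia.
  rewrite (conv_count_alpha HB) // -conv_eq //.
  move: leHX (conv_count_partition HB sXA Ag).
  rewrite (conv_count_stable cAA (sub_H HB) sXA stabX Ag).
  case: eqP => [-> | _]; first by rewrite (negPf X'1); clear; lia.
  by case: ifP => _; clear; lia.
move: leHX (conv_count_partitionY HB Aa).
rewrite (conv_count_stable cAA (sub_H HB) sYA stabY Aa) -cardXY.
by case: ifP => _; clear; lia.
Qed.

End Sufficiency.

End IndexTwo.

(** * The index-two decomposition and the final assembly *)

Lemma index2_rcoset (gT : finGroupType) (A : {group gT}) (b g : gT) :
  #|[set: gT] : A| = 2 -> b \notin A -> g \notin A -> g * b^-1 \in A.
Proof.
move=> indexA notAb notAg.
have cardG : #|[set: gT]| = (2 * #|A|)%N.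
  by rewrite -indexA mulnC Lagrange ?subsetT.
have defG : A :|: A :* b = [set: gT].
  apply/eqP; rewrite eqEcard subsetT cardG cardsU card_rcoset.
  rewrite (_ : A :&: A :* b = set0) ?cards0 ?subn0 ?mul2n ?addnn //=.
  apply/setP => a; rewrite inE in_set0 mem_rcoset.
  by apply/negP => /andP[Aa]; rewrite groupMl // groupV (negPf notAb).
by have := in_setT g; rewrite -defG inE (negPf notAg) mem_rcoset.
Qed.

Local Close Scope group_scope.

Theorem theorem2 (R : realType) (gT : finGroupType) (n : nat)
    (A : {group gT}) (alpha b : gT) (f : {perm gT}) (X Y : {set gT})
    (n_gt1 : 1 < n)
    (cardG : #|[set: gT]| = 2 * n)
    (nonabelG : ~~ abelian [set: gT])
    (abelA : abelian A)
    (indexA : #|[set: gT] : A|%g = 2)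
    (alphaA : alpha \in A)
    (genG : <<b |: A>>%g = [set: gT])
    (b_sq : (b ^+ 2)%g = alpha)
    (b_conj : forall a, a \in A -> (b * a * b^-1)%g = f a)
    (fAut : f \in Aut A)
    (f_order : #[f]%g = 2)
    (f_alpha : f alpha = alpha)
    (XA : X \subset A :\ 1%g)
    (YA : Y \subset A)
    (X_n0 : X != set0)
    (Xf : X :&: f @: X = set0)
    (Yf : Y :&: f @: Y = set0)
    (cardXY : #|X| = #|Y|) :
  let B := A :\: (X :|: f @: X) in
  let Gamma := cayley (X :|: Y :* b)%g in
  let Xbar := gset_mx (complex R) A X in
  let Ybar := gset_mx (complex R) A Y in
  (is_dsrg Gamma <->
     [/\ group_set B,
         union_of_cosets B A X /\ union_of_cosets B A Y &
         X :|: f @: X = Y :|: f @: Y /\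
         (Xbar *m gring_lin f Xbar = Ybar *m gring_lin f Ybar)%R]) /\
  (is_dsrg Gamma ->
     exists k mu lambda t : nat,
       dsrg_with Gamma (2 * n) k mu lambda t /\
       let n' := n%:R%R : rat in
       let l := #|B|%:R%R : rat in
       [/\ k%:R = n' - l,
           mu%:R = (n' - l) / 2,
           lambda%:R = (n' - 3 * l) / 2 &
           t%:R = (n' - l) / 2]%R).
Proof.
move=> B Gamma Xbar Ybar; subst alpha.
have fK : involutive f.
  by move=> g; rewrite -permM -expg2 -f_order expg_order perm1.
have notAb : b \notin A.
  apply/negP => Ab; have defG : [set: gT] = A.
    by rewrite -genG (setUidPr _) ?sub1set // genGid.
  by move: indexA; rewrite defG indexgg.
have AbP g := @index2_rcoset gT A b g indexA notAb.
have sXA : X \subset A := subset_trans XA (subsetDl _ _).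
have X'1 : 1%g \notin X by apply/negP => /(subsetP XA); rewrite !inE eqxx.
have sfXA := sub_imset_aut fAut sXA; have sfYA := sub_imset_aut fAut YA.
have cardA : #|A| = n.
  apply/eqP; rewrite -(eqn_pmul2l (isT : 0 < 2)) -cardG -indexA mulnC.
  by rewrite Lagrange ?subsetT.
(* The algebra identity in (iii) is passed to convolution counts, the form used in both
   directions. *)
have XYbarP : (Xbar *m gring_lin f Xbar = Ybar *m gring_lin f Ybar)%R
    <-> {in A, conv_count (f @: X) X =1 conv_count (f @: Y) Y}.
  by rewrite !gring_lin_gset //; apply: gset_mx_mul_eq.
have necessary : is_dsrg Gamma ->
    [/\ group_set B, union_of_cosets B A X /\ union_of_cosets B A Y &
        X :|: f @: X = Y :|: f @: Y /\
        (Xbar *m gring_lin f Xbar = Ybar *m gring_lin f Ybar)%R].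
  case=> [N [k [mu [la [t]]]]].
  case/(dsrg_conv_countP abelA notAb AbP alphaA b_conj fAut sXA X'1 YA Xf
          cardXY).
  move=> _ _ _ E1 E2.
  have gB : group_set B.
    exact: (dsrg_group_set_B abelA alphaA fAut fK f_alpha sXA X'1 YA X_n0
              Xf cardXY E1 E2).
  pose H := Group gB; have HB : H = B :> {set gT} by [].
  split; [exact: gB | split | split].
  - apply/(union_of_cosetsP H sXA) => h x Hh Xx.
    exact: (dsrg_X_stable abelA alphaA fAut fK f_alpha sXA X'1 YA X_n0
              Xf cardXY E1 E2 HB).
  - apply/(union_of_cosetsP H YA) => h y Hh Yy.
    exact: (dsrg_Y_stable abelA alphaA fAut fK f_alpha sXA X'1 YA X_n0
              Xf cardXY E1 E2 HB).
  - exact: (dsrg_Y_cover abelA alphaA fAut fK f_alpha sXA X'1 YA X_n0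
              Xf Yf cardXY E1 E2 HB).
  apply/XYbarP => g Ag.
  exact: (dsrg_conv_eq abelA alphaA fAut fK f_alpha sXA X'1 YA X_n0
            Xf cardXY E1 E2 HB).
have sufficient :
    [/\ group_set B, union_of_cosets B A X /\ union_of_cosets B A Y &
        X :|: f @: X = Y :|: f @: Y /\
        (Xbar *m gring_lin f Xbar = Ybar *m gring_lin f Ybar)%R] ->
    #|B| <= #|X| /\
    dsrg_with Gamma (2 * n) (2 * #|X|) #|X| (#|X| - #|B|) #|X|.
  case=> gB [cosX cosY] [_ /XYbarP conv_eq].
  pose H := Group gB; have HB : H = B :> {set gT} by [].
  have stabX : {in H & X, forall h x, (h * x)%g \in X}.
    exact/(union_of_cosetsP H sXA).
  have stabY : {in H & Y, forall h y, (h * y)%g \in Y}.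
    exact/(union_of_cosetsP H YA).
  split; first exact: (leq_card_stable X_n0 stabX).
  rewrite -cardG cardsT.
  exact: (dsrg_sufficient abelA notAb AbP alphaA b_conj fAut fK f_alpha sXA X'1
            YA X_n0 Xf cardXY HB stabX stabY conv_eq).
split; first split=> [/necessary // | /sufficient[_ dsrgG]].
  by exists (2 * n), (2 * #|X|), #|X|, (#|X| - #|B|), #|X|.
case/necessary/sufficient => leBX dsrgG.
exists (2 * #|X|), #|X|, (#|X| - #|B|), #|X|; split=> //=.
(* Since [n = #|A| = 2 * #|X| + #|B|], [#|X|] is [(n - l) / 2]; [leBX] lets the subtraction for
   lambda pass to the rationals. *)
rewrite -cardA (cardA_eq fAut sXA Xf) -/B natrB // natrD natrM.
by split=> //; field.
Qed.
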